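(* Let $p,q\ge2$ be distinct integers, let $m,n\ge1$, and put $$G=K_p^{\square m}\square K_q^{\square n},\qquad g=\gcd(p,q),\quad p'=p/g,\quad q'=q/g .$$ Then, at every root $a\in V(G)$, \begin{align*} \dim P_a(G)&=(m+1)(n+1)-(m-2q'+1)_+(n-2p'+1)_+-1,\\ \delta_{\ominus}(G,a)&=(m-2q'+1)_+(n-2p'+1)_+ . \end{align*} In particular $P_a=U_a^-$ if and only if $m<2q'$ or $n<2p'$.
   Context: $K_p$ is the complete graph on $p$ vertices, $\square$ the Cartesian product of graphs, $F^{\square m}$ the $m$-fold Cartesian power, and $x_+=\max\{x,0\}$. All vector spaces and algebras are over $\mathbb R$. For a finite simple connected regular graph $G$ with at least two vertices and $a\in V(G)$: $B=A(G-a)$ is the adjacency matrix of the vertex-deleted graph, $E$ is the diagonal matrix indexed by $V(G)\setminus\{a\}$ with diagonal the indicator of the neighbourhood $N(a)$, $\mathbf 1$ is the all-ones vector on $V(G)\setminus\{a\}$, $\mathcal B_a=\langle I,B,E\rangle$ is the real unital algebra generated by $B$ and $E$, and $P_a=P_a(G)=\mathcal B_a\mathbf 1$. Further, $\operatorname{Aut}(G)_a$ is the stabilizer of $a$ in the automorphism group, $U_a^-=(\mathbb R^{V(G)\setminus\{a\}})^{\operatorname{Aut}(G)_a}$ is the space of vectors on $V(G)\setminus\{a\}$ that are constant on $\operatorname{Aut}(G)_a$-orbits, and $\delta_{\ominus}(G,a)=\dim U_a^--\dim P_a$. *)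

(* Defs.v *)
From HB Require Import structures.
From mathcomp Require Import all_boot all_order all_algebra all_fingroup.
From mathcomp Require Import reals.

Set Implicit Arguments.
Unset Strict Implicit.
Unset Printing Implicit Defensive.

Import Order.TTheory GRing.Theory Num.Theory.
Local Open Scope ring_scope.

(* A finite graph is given by its adjacency relation on a finType. *)

Definition complete_graph (p : nat) : rel 'I_p := fun x y => x != y.

Arguments complete_graph p x y : clear implicits.

Definition cart_prod (S T : finType) (eS : rel S) (eT : rel T) : rel (S * T) :=
  fun x y => (x.1 == y.1) && eT x.2 y.2 || eS x.1 y.1 && (x.2 == y.2).

Definition cart_pow (T : finType) (e : rel T) (m : nat) : rel {ffun 'I_m -> T} :=
  fun x y => [exists i, e (x i) (y i) && [forall j, (j != i) ==> (x j == y j)]].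

Arguments cart_pow {T} e m x y.

Definition graph_aut (T : finType) (e : rel T) : {set {perm T}} :=
  [set s : {perm T} | [forall x, forall y, e (s x) (s y) == e x y]].

Definition aut_stab (T : finType) (e : rel T) (a : T) : {set {perm T}} :=
  'C_(graph_aut e)[a | 'P]%g.

Section GeneratedAlgebra.
Variables (R : fieldType) (N : nat).

Definition unital_subalgebra (U : {vspace 'M[R]_N}) : Prop :=
  1%:M \in U /\ {in U &, forall X Y, X *m Y \in U}.

Definition gen_step (S : seq 'M[R]_N) (U : {vspace 'M[R]_N}) : {vspace 'M[R]_N} :=
  (U + \sum_(X <- S) (linfun (mulmx X) @: U))%VS.

(* The dimension of the iterates is at most N * N, so N * N steps suffice; see
   gen_alg_subalgebra, mem_gen_alg and gen_alg_min for the characterization as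
   the least unital subalgebra containing S. *)
Definition gen_alg (S : seq 'M[R]_N) : {vspace 'M[R]_N} :=
  iter (N * N) (gen_step S) <[1%:M]>%VS.

Lemma gen_step_sub S (U : {vspace 'M[R]_N}) : (U <= gen_step S U)%VS.
Proof. exact: addvSl. Qed.

Lemma gen_step_mul S (U : {vspace 'M[R]_N}) (X Y : 'M[R]_N) : X \in S -> Y \in U -> X *m Y \in gen_step S U.
Proof.
move=> XS YU; rewrite /gen_step (big_rem X) //=.
have h : X *m Y \in (linfun (mulmx X) @: U)%VS.
  by apply/memv_imgP; exists Y => //; rewrite lfunE.
by apply: (subvP (addvSr _ _)); apply: (subvP (addvSl _ _)).
Qed.

Lemma gen_step_least S (U W : {vspace 'M[R]_N}) :
  (forall X Y, X \in S -> Y \in W -> X *m Y \in W) ->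
  (U <= W)%VS -> (gen_step S U <= W)%VS.
Proof.
move=> hW UW; rewrite /gen_step subv_add UW /= big_seq.
elim/big_ind: _ => [|V1 V2 h1 h2|X XS]; first exact: sub0v.
  by rewrite subv_add h1.
apply/subvP=> _ /memv_imgP[Y YU ->]; rewrite lfunE /=.
exact/hW/(subvP UW).
Qed.

Lemma gen_alg_fix S : gen_step S (gen_alg S) = gen_alg S.
Proof.
pose U k := iter k (gen_step S) <[1%:M]>%VS.
have grow k : gen_step S (U k) = U k \/ (k <= \dim (U k))%N.
  elim: k => [|k [fixk|lek]]; [by right | by left; rewrite /= !fixk |].
  have [/eqP fixk|nfix] := boolP (gen_step S (U k) == U k).
    by left; rewrite /= !fixk.
  right; apply: leq_ltn_trans lek _; rewrite ltnNge; apply: contra nfix => led.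
  by rewrite eq_sym eqEdim gen_step_sub.
case: (grow (N * N)%N) => // led; apply/eqP; rewrite eq_sym eqEdim gen_step_sub.
by apply: leq_trans led; rewrite (leq_trans (dimvS (subvf _))) // dimvf.
Qed.

Lemma gen_alg_mull S (X Y : 'M[R]_N) : X \in S -> Y \in gen_alg S -> X *m Y \in gen_alg S.
Proof. by move=> XS YU; rewrite -gen_alg_fix gen_step_mul. Qed.

Lemma gen_alg1 S : 1%:M \in gen_alg S.
Proof.
rewrite /gen_alg; elim: (N * N)%N => [|k IHk]; first exact: memv_line.
exact: (subvP (gen_step_sub _ _)).
Qed.

Lemma gen_alg_least S (W : {vspace 'M[R]_N}) : 1%:M \in W ->
  (forall X Y, X \in S -> Y \in W -> X *m Y \in W) -> (gen_alg S <= W)%VS.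
Proof.
rewrite /gen_alg => W1 hW; elim: (N * N)%N => [|k IHk] /=.
  by rewrite -memvE.
exact: gen_step_least.
Qed.

Lemma mem_gen_alg S : {subset S <= gen_alg S}.
Proof. by move=> X XS; rewrite -[X]mulmx1 gen_alg_mull ?gen_alg1. Qed.

Lemma gen_alg_subalgebra S : unital_subalgebra (gen_alg S).
Proof.
split=> [|X Y XU YU]; first exact: gen_alg1.
suff /subvP/(_ _ XU) : (gen_alg S <= linfun (mulmxr Y) @^-1: gen_alg S)%VS.
  by rewrite -memv_preim lfunE.
apply: gen_alg_least => [|Z X' ZS]; first by rewrite -memv_preim lfunE /= mul1mx.
rewrite -!memv_preim !lfunE /= -mulmxA; exact: gen_alg_mull.
Qed.

Lemma gen_alg_min S (W : {vspace 'M[R]_N}) :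
  unital_subalgebra W -> {subset S <= W} -> (gen_alg S <= W)%VS.
Proof.
case=> W1 WM SW; apply: gen_alg_least => // X Y XS YW; exact/WM/YW/SW.
Qed.

End GeneratedAlgebra.

Section RootedGraph.
Variables (R : realType) (T : finType) (e : rel T) (a : T).

(* V(G) \ {a} is enumerated by 'I_#|[set~ a]| via enum_val. *)
Local Notation N := #|[set~ a]|.

Definition deleted_adj : 'M[R]_N :=
  \matrix_(i, j) (e (enum_val i) (enum_val j))%:R.

Definition nbr_diag : 'M[R]_N := diag_mx (\row_i (e a (enum_val i))%:R).

Definition root_alg : {vspace 'M[R]_N} := gen_alg [:: deleted_adj; nbr_diag].

Definition root_space : {vspace 'cV[R]_N} :=
  (linfun (mulmxr (const_mx 1 : 'cV[R]_N)) @: root_alg)%VS.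

(* The linear functional v |-> v i - v j, as a row vector. *)
Definition coord_diff (i j : 'I_N) : 'rV[R]_N := delta_mx 0 i - delta_mx 0 j.

Definition orbit_space : {vspace 'cV[R]_N} :=
  (\bigcap_(i : 'I_N) \bigcap_(j : 'I_N | enum_val j \in orbit 'P (aut_stab e a) (enum_val i))
     lker (linfun (mulmx (coord_diff i j))))%VS.

Lemma orbit_spaceP (v : 'cV[R]_N) :
  reflect (forall i j : 'I_N,
             enum_val j \in orbit 'P (aut_stab e a) (enum_val i) ->
             v i 0 = v j 0)
          (v \in orbit_space).
Proof.
have dmxE (i : 'I_N) : (delta_mx 0 i : 'rV[R]_N) *m v = (v i 0)%:M.
  by rewrite -rowE [LHS]mx11_scalar mxE.
have kerE i j : (v \in lker (linfun (mulmx (coord_diff i j))))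
    = (v i 0 == v j 0).
  rewrite memv_ker lfunE /= mulmxBl !dmxE subr_eq0; apply/eqP/eqP => [|-> //].
  by move/matrixP/(_ 0 0); rewrite !mxE.
apply: (iffP idP) => [vU i j oij|vU].
  apply/eqP; rewrite -kerE; move: v vU {dmxE kerE}; apply/subvP.
  by apply: (bigcapv_inf i) => //; apply: (bigcapv_inf j oij); apply: subvv.
rewrite memvE; apply/subv_bigcapP => i _; apply/subv_bigcapP => j oij.
by rewrite -memvE kerE; apply/eqP/vU.
Qed.

Definition root_defect : int := (\dim orbit_space)%:Z - (\dim root_space)%:Z.

End RootedGraph.

Definition pos_part (x : int) : int := Num.max x 0.

(* Main.v *)
Require Import Defs.
From HB Require Import structures.
From mathcomp Require Import all_boot all_order all_algebra all_fingroup.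
From mathcomp Require Import reals.
From mathcomp Require Import zify ring.

(** Two vertices are in the same orbit of the stabilizer of the root a exactly
    when they have the same pair (i, j) of Hamming distances to a in the two
    factors: since p <> q, an edge remembers its factor through its number of
    common neighbours, p - 2 or q - 2 ([orbit_level]).  Hence the orbit space
    has dimension (m + 1)(n + 1) - 1 ([dim_orbit_space]).

    For the root space P, add the root back and diagonalize.  The coefficients
    of the polynomials prod_k (1 + w_k X), with w_k = p - 1 where x and a agree
    and w_k = -1 elsewhere, are eigenfunctions of the adjacency operator of the
    first factor; the same holds in the second one, and the products of the two
    families are parametrized by the grid of the (s, t) with s <= m and t <= n.
    An array C on this grid gives a function on the vertices ([spectral]), and
    in these coordinates

    - the adjacency operator multiplies C by K - (p s + q t), K a constant;
    - the constant array 1 is, up to a factor, the indicator of the root;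
    - the array of the eigenvalues of the first factor, which is affine in s,
      is the indicator of the neighbours of the root in the first factor.

    The matrix E cuts out neighbours of the root, and E B E 1 takes the distinct
    values p - 2 and q - 2 on the two kinds of neighbours, so P contains both
    indicators ([nbr_in_root_space]).  Therefore P, enlarged by the root, is the
    set of the arrays f(p s + q t) + s g(p s + q t), with f and g arbitrary.
    With u = p / gcd(p, q) and v = q / gcd(p, q), these are the arrays that are
    affine along each line u s + v t = const of the grid
    ([root_spectral_image]).  Consecutive points of such a line differ by
    (v, - u), so the condition is that all second differences with step (v, - u)
    vanish.  There are (m + 1 - 2 v)_+ (n + 1 - 2 u)_+ of them, and they are
    independent ([second_diff_onto]); this gives dim P, where one dimension is
    lost to the root, and the defect. *)

Set Implicit Arguments.
Unset Strict Implicit.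
Unset Printing Implicit Defensive.

Import Order.TTheory GRing.Theory Num.Theory.
Local Open Scope ring_scope.

(** * The Hamming distance on a power of a complete graph *)

Section Hamming.
Variables (m p : nat).
Implicit Types x y z a : {ffun 'I_m -> 'I_p}.

Definition hamming x y : nat := #|[set k | x k != y k]|.

Lemma hammingC x y : hamming x y = hamming y x.
Proof. by apply: eq_card => k; rewrite !inE eq_sym. Qed.

Lemma hamming_eq0 x y : (hamming x y == 0)%N = (x == y).
Proof.
rewrite cards_eq0; apply/eqP/eqP => [h|->].
  by apply/ffunP=> k; move/setP/(_ k): h; rewrite !inE => /negbFE/eqP.
by apply/setP=> k; rewrite !inE eqxx.
Qed.

Lemma hammingxx x : hamming x x = 0%N.
Proof. by apply/eqP; rewrite hamming_eq0. Qed.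

Lemma hamming_triangle x y z : (hamming x z <= hamming x y + hamming y z)%N.
Proof.
apply: leq_trans (leq_card_setU _ _); apply/subset_leq_card/subsetP => k.
by rewrite !inE -negb_and; apply: contraNN => /andP[/eqP-> /eqP->].
Qed.

Lemma cart_pow_complete x y :
  cart_pow (complete_graph p) m x y = (hamming x y == 1)%N.
Proof.
apply/existsP/cards1P => -[k].
  case/andP=> nk /forallP h; exists k; apply/setP=> l; rewrite !inE.
  by have [->|nl] := eqVneq l k; [exact: nk | apply/negbF; rewrite (implyP (h l))].
move/setP=> h; exists k; have := h k; rewrite !inE eqxx => nk.
rewrite /complete_graph nk; apply/forallP=> l; apply/implyP=> nl.
by have := h l; rewrite !inE (negPf nl) => /negbFE.
Qed.

Definition upd x k b : {ffun 'I_m -> 'I_p} := [ffun l => if l == k then b else x l].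

(** Resetting one coordinate of x to its value in a moves x one step closer. *)
Lemma hamming_toward a x : (0 < hamming a x)%N ->
  exists y, hamming y x = 1%N /\ (hamming a y).+1 = hamming a x.
Proof.
rewrite card_gt0 => /set0Pn[k]; rewrite inE => nk.
exists (upd x k (a k)); split.
  rewrite /hamming -(cards1 k); congr #|pred_of_set _|; apply/setP=> l.
  by rewrite !inE ffunE; case: (eqVneq l k) => [->|]; rewrite ?nk ?eqxx.
rewrite [RHS](cardsD1 k) inE nk add1n; congr _.+1.
apply: eq_card => l; rewrite !inE ffunE.
by case: (eqVneq l k) => [->|]; rewrite ?eqxx.
Qed.

Lemma hamming_onto a i : (1 < p)%N -> (i <= m)%N -> exists x, hamming a x = i.
Proof.
move=> p1 im.
have ex (b : 'I_p) : exists c : 'I_p, b != c.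
  have [b0|nb] := eqVneq (val b) 0%N.
    by exists (Ordinal p1); rewrite -val_eqE /= b0.
  by exists (Ordinal (ltnW p1)); rewrite -val_eqE.
pose f (k : 'I_m) := if (k < i)%N then xchoose (ex (a k)) else a k.
exists [ffun k : 'I_m => f k].
have inj : injective (widen_ord im) by move=> j k /(congr1 val)/= /val_inj.
rewrite /hamming -[RHS](card_ord i) -(card_imset _ inj).
apply: eq_card => k; rewrite inE ffunE /f.
apply/idP/imsetP => [|[j _ ->]].
  by case: ifP => ki; rewrite ?eqxx // => _; exists (Ordinal ki) => //; apply/val_inj.
by rewrite /= ltn_ord; exact: (xchooseP (ex _)).
Qed.

(** A common neighbour of two adjacent vertices differs from both in the only
    coordinate where they differ. *)
Lemma card_common_nbr x y : hamming x y = 1%N ->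
  #|[set z | (hamming x z == 1)%N && (hamming z y == 1)%N]| = (p - 2)%N.
Proof.
move=> h1; have /cards1P[k /setP hk] : (hamming x y == 1)%N by rewrite h1.
have nk : x k != y k by have := hk k; rewrite !inE eqxx.
have ek l : l != k -> x l = y l.
  by move=> nl; have := hk l; rewrite !inE (negPf nl) => /negbFE/eqP.
have -> : (p - 2 = #|~: [set x k; y k]|)%N.
  by rewrite cardsCs setCK cards2 nk card_ord.
have inj : injective (upd x k).
  by move=> b c /ffunP/(_ k); rewrite !ffunE eqxx.
rewrite -(card_imset _ inj); apply: eq_card => z; rewrite inE.
apply/andP/imsetP => [[hxz hzy]|[b + ->]].
  have [l hl] := cards1P hxz; have [l' hl'] := cards1P hzy.
  have xz j : (x j != z j) = (j == l) by move/setP/(_ j): hl; rewrite !inE.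
  have zy j : (z j != y j) = (j == l') by move/setP/(_ j): hl'; rewrite !inE.
  have lk : l = k.
    apply/eqP; apply: contraNT nk => nlk.
    have xzk : x k = z k by apply/eqP; rewrite -[_ == _]negbK xz eq_sym.
    have := zy l; rewrite -ek // eq_sym xz eqxx => /esym/eqP ll'.
    by rewrite xzk -[_ == _]negbK zy -ll' eq_sym.
  subst l; exists (z k).
    rewrite !inE negb_or eq_sym xz eqxx /= zy eq_sym; apply: contraT => nl.
    by have := zy l'; rewrite eqxx -ek // eq_sym xz (negPf nl).
  apply/ffunP=> j; rewrite ffunE; case: (eqVneq j k) => [->//|nj].
  by apply/esym/eqP; rewrite -[_ == _]negbK xz.
rewrite !inE negb_or => /andP[bx by_].
split; apply/cards1P; exists k; apply/setP=> j; rewrite !inE ffunE.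
  by case: (eqVneq j k) => [->|]; rewrite ?eqxx // eq_sym.
by case: (eqVneq j k) => [->|nj]; [rewrite by_ | rewrite ek ?eqxx].
Qed.

(** Permute the coordinates so that the places where x differs from a are moved
    to those where y differs from b, then act in each coordinate by a
    permutation of the alphabet: a product of two transpositions carries one
    pair of letters to another, when both are equal or both are distinct. *)
Lemma hamming_transport a b x y : hamming a x = hamming b y ->
  exists s : {perm {ffun 'I_m -> 'I_p}},
    [/\ s a = b, s x = y & forall z w, hamming (s z) (s w) = hamming z w].
Proof.
move=> hxy.
have [pi hpi] : exists pi : 'S_m, forall k, (b k == y k) = (a (pi k) == x (pi k)).
  pose tx := [tuple a k == x k | k < m]; pose ty := [tuple b k == y k | k < m].
  (* Two boolean tuples with as many true entries are rearrangements. *)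
  have /tuple_permP[pi e] : perm_eq ty tx.
    have cnt (z w : {ffun 'I_m -> 'I_p}) :
        count_mem false [tuple z k == w k | k < m] = hamming z w.
      rewrite count_map /= /hamming [RHS]cardE {2}/enum_mem size_filter enumT.
      by apply: eq_count => k; rewrite /= !inE eqbF_neg.
    have cnt' (z w : {ffun 'I_m -> 'I_p}) :
        count_mem true [tuple z k == w k | k < m] = (m - hamming z w)%N.
      have := count_predC (pred1 false) [tuple z k == w k | k < m].
      rewrite size_tuple cnt => /(congr1 (subn^~ (hamming z w)))/= <-.
      by rewrite addKn; apply: eq_count => -[].
    by apply/allP => -[] _ /=; rewrite ?cnt ?cnt' hxy.
  exists pi => k; have := congr1 (fun s => nth (b k == y k) s k) e.
  by rewrite !nth_mktuple tnth_mktuple.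
pose tau k := (tperm (a (pi k)) (b k) * tperm (tperm (a (pi k)) (b k) (x (pi k))) (y k))%g.
have tau_a k : tau k (a (pi k)) = b k.
  rewrite permM tpermL; case: (eqVneq (b k) (y k)) => [e|ne].
    have := hpi k; rewrite e eqxx => /esym/eqP <-.
    by rewrite tpermL tperm1 perm1.
  rewrite tpermD //; last by rewrite eq_sym.
  by rewrite -{2}(tpermL (a (pi k)) (b k)) (inj_eq perm_inj) eq_sym -hpi.
have tau_x k : tau k (x (pi k)) = y k by rewrite permM tpermL.
pose f z : {ffun 'I_m -> 'I_p} := [ffun k => tau k (z (pi k))].
have hf z w : hamming (f z) (f w) = hamming z w.
  rewrite /hamming -[RHS](card_preimset _ (@perm_inj _ pi)).
  by apply: eq_card => k; rewrite !inE !ffunE (inj_eq perm_inj).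
have f_inj : injective f.
  by move=> z w e; apply/eqP; rewrite -hamming_eq0 -hf e hammingxx.
exists (perm f_inj); split=> [||z w]; rewrite ?permE //.
- by apply/ffunP=> k; rewrite ffunE.
- by apply/ffunP=> k; rewrite ffunE.
Qed.

End Hamming.

(** * Orbits of the stabilizer of the root *)

Section RootRestriction.
Variables (R : realType) (S : finType) (a : S).

Definition root_restr (F : S -> R) : 'cV[R]_#|[set~ a]| := \col_i F (enum_val i).

Lemma root_restr_at F x : x != a -> exists k, enum_val k = x /\ root_restr F k 0 = F x.
Proof.
move=> xa; have hx : x \in [set~ a] by rewrite !inE.
by exists (enum_rank_in hx x); rewrite mxE enum_rankK_in.
Qed.

Lemma root_restrP F H :
  (forall x, x != a -> F x = H x) <-> root_restr F = root_restr H.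
Proof.
split=> [h|/matrixP h x xa].
  apply/matrixP=> k j; rewrite !mxE h //.
  by have := enum_valP k; rewrite !inE.
by have [k [<- _]] := root_restr_at F xa; have := h k 0; rewrite !mxE.
Qed.

End RootRestriction.

Section ProductGraph.
Variables (m p n q : nat).
Local Notation T := ({ffun 'I_m -> 'I_p} * {ffun 'I_n -> 'I_q})%type.
Implicit Types x y z a : T.

Definition hamming_prod : rel T :=
  cart_prod (cart_pow (complete_graph p) m) (cart_pow (complete_graph q) n).
Local Notation G := hamming_prod.

Lemma hamming_prodE x y :
  G x y = (hamming x.1 y.1 + hamming x.2 y.2 == 1)%N.
Proof.
rewrite /G /cart_prod !cart_pow_complete -!hamming_eq0.
by case: (hamming x.1 y.1) => [|[|i]]; case: (hamming x.2 y.2) => [|[|j]].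
Qed.

Lemma hamming_prod_sym x y : G x y = G y x.
Proof. by rewrite !hamming_prodE !(hammingC x.1, hammingC x.2). Qed.

Lemma card_common_nbr1 x y : hamming x.1 y.1 = 1%N -> hamming x.2 y.2 = 0%N ->
  #|[set z | G x z && G z y]| = (p - 2)%N.
Proof.
case: x y => [x1 x2] [y1 y2] /= h1 /eqP; rewrite hamming_eq0 => /eqP <-{y2}.
rewrite -(card_common_nbr h1) -[RHS]muln1 -[X in (_ * X)%N](cards1 x2) -cardsX.
apply: eq_card => -[z1 z2]; rewrite !inE !hamming_prodE /= -hamming_eq0 (hammingC z2).
case: (hamming x2 z2) => [|[|j]] /=; rewrite ?addn0 ?andbT ?andbF ?addn1 //.
  apply/negP => /andP[]; rewrite !eqSS !hamming_eq0 => /eqP <- /eqP e.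
  by move: h1; rewrite e hammingxx.
by rewrite !addnS.
Qed.

Lemma card_common_nbr2 x y : hamming x.1 y.1 = 0%N -> hamming x.2 y.2 = 1%N ->
  #|[set z | G x z && G z y]| = (q - 2)%N.
Proof.
case: x y => [x1 x2] [y1 y2] /= /eqP + h1; rewrite hamming_eq0 => /eqP <-{y1}.
rewrite -(card_common_nbr h1) -[RHS]mul1n -[X in (X * _)%N](cards1 x1) -cardsX.
apply: eq_card => -[z1 z2]; rewrite !inE !hamming_prodE /= -hamming_eq0 (hammingC z1).
case: (hamming x1 z1) => [|[|j]] //=.
apply/negP => /andP[]; rewrite !eqSS !hamming_eq0 => /eqP <- /eqP e.
by move: h1; rewrite e hammingxx.
Qed.

Lemma aut_stabP a (s : {perm T}) :
  reflect ((forall x y, G (s x) (s y) = G x y) /\ s a = a) (s \in aut_stab G a).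
Proof.
rewrite inE; apply: (iffP andP) => -[].
  rewrite inE => /forallP h /astab1P sa; split=> // x y.
  by apply/eqP; move: y; apply/forallP.
move=> h sa; split; last exact/astab1P.
by rewrite inE; apply/forallP => x; apply/forallP=> y; rewrite h.
Qed.

Hypotheses (hp : (2 <= p)%N) (hq : (2 <= q)%N) (hpq : p <> q).

Lemma aut_card_common (s : {perm T}) x y :
  (forall x y, G (s x) (s y) = G x y) ->
  #|[set z | G (s x) z && G z (s y)]| = #|[set z | G x z && G z y]|.
Proof.
move=> hs; rewrite -(card_preimset _ (@perm_inj _ s)).
by apply: eq_card => z; rewrite !inE !hs.
Qed.

(** The number of common neighbours of the ends of an edge reveals the factor
    in which the edge lies, because p - 2 <> q - 2. *)
Lemma aut_edge1 (s : {perm T}) x y :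
  (forall x y, G (s x) (s y) = G x y) ->
  hamming x.1 y.1 = 1%N -> hamming x.2 y.2 = 0%N ->
  hamming (s x).1 (s y).1 = 1%N /\ hamming (s x).2 (s y).2 = 0%N.
Proof.
move=> hs h1 h2; have := aut_card_common x y hs.
have := hs x y; rewrite (card_common_nbr1 h1 h2) !hamming_prodE h1 h2.
case e1: (hamming _ _) => [|[|i]]; case e2: (hamming _ _) => [|[|j]] // _.
rewrite card_common_nbr2 //; lia.
Qed.

Lemma aut_edge2 (s : {perm T}) x y :
  (forall x y, G (s x) (s y) = G x y) ->
  hamming x.1 y.1 = 0%N -> hamming x.2 y.2 = 1%N ->
  hamming (s x).1 (s y).1 = 0%N /\ hamming (s x).2 (s y).2 = 1%N.
Proof.
move=> hs h1 h2; have := aut_card_common x y hs.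
have := hs x y; rewrite (card_common_nbr2 h1 h2) !hamming_prodE h1 h2.
case e1: (hamming _ _) => [|[|i]]; case e2: (hamming _ _) => [|[|j]] // _.
rewrite card_common_nbr1 //; lia.
Qed.

(** The image of a shortest path from a to x starts at a and has as many edges
    of each factor, and an edge changes only the distance in its own factor, by
    at most one. *)
Lemma aut_stab_level_le a (s : {perm T}) x : s \in aut_stab G a ->
  (hamming a.1 (s x).1 <= hamming a.1 x.1)%N /\
  (hamming a.2 (s x).2 <= hamming a.2 x.2)%N.
Proof.
case/aut_stabP => hs sa.
have [N] := ubnP (hamming a.1 x.1 + hamming a.2 x.2); elim: N x => // N IHN x leN.
have [h1|h1] := posnP (hamming a.1 x.1); last first.
  have [y1 [yx ay]] := hamming_toward h1; pose y : T := (y1, x.2).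
  have [] := IHN y; first by rewrite /=; lia.
  have [] := @aut_edge1 s y x hs yx (hammingxx _).
  move=> t1 /eqP; rewrite hamming_eq0 => /eqP t2; rewrite t2 => l1 l2; split=> //.
  by apply: leq_trans (hamming_triangle _ (s y).1 _) _; rewrite t1 addn1 -ay ltnS.
have [h2|h2] := posnP (hamming a.2 x.2); last first.
  have [y2 [yx ay]] := hamming_toward h2; pose y : T := (x.1, y2).
  have [] := IHN y; first by rewrite /=; lia.
  have [] := @aut_edge2 s y x hs (hammingxx _) yx.
  move=> /eqP + t1; rewrite hamming_eq0 => /eqP t2; rewrite t2 => l1 l2; split=> //.
  by apply: leq_trans (hamming_triangle _ (s y).2 _) _; rewrite t1 addn1 -ay ltnS.
have -> : x = a.
  move/eqP: h1; move/eqP: h2; rewrite !hamming_eq0 => /eqP + /eqP.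
  by case: (x) (a) => [? ?] [? ?] /= -> ->.
by rewrite sa !hammingxx.
Qed.

Lemma orbit_level a x y :
  (y \in orbit 'P (aut_stab G a) x)
  = (hamming a.1 x.1 == hamming a.1 y.1) && (hamming a.2 x.2 == hamming a.2 y.2).
Proof.
apply/orbitP/andP => [[s hs <-]|[/eqP h1 /eqP h2]].
  have [l1 l2] := aut_stab_level_le x hs.
  have hsV : (s^-1)%g \in aut_stab G a.
    case/aut_stabP: hs => h sa; apply/aut_stabP; split=> [z w|].
      by rewrite -h !permKV.
    by rewrite -{1}sa permK.
  have [k1 k2] := aut_stab_level_le (s x) hsV.
  move: k1 k2; rewrite permK /= => k1 k2.
  by split; rewrite eqn_leq; apply/andP.
have [s1 [a1 x1 e1]] := hamming_transport h1.
have [s2 [a2 x2 e2]] := hamming_transport h2.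
pose f z : T := (s1 z.1, s2 z.2).
have f_inj : injective f by move=> [z1 z2] [w1 w2] [/perm_inj-> /perm_inj->].
exists (perm f_inj).
  apply/aut_stabP; split=> [z w|]; first by rewrite !permE !hamming_prodE e1 e2.
  by rewrite permE /f a1 a2; case: (a).
by rewrite /= /aperm permE /f x1 x2; case: (y).
Qed.

Variable (R : realType) (a : T).

(** Vectors that are constant on levels; the entry of C at the root is lost. *)
Definition level_vec (C : 'M[R]_(m.+1, n.+1)) : 'cV[R]_#|[set~ a]| :=
  root_restr a (fun x => C (inord (hamming a.1 x.1)) (inord (hamming a.2 x.2))).

Lemma level_vec_linear : linear level_vec.
Proof. by move=> c C D; apply/matrixP=> i j; rewrite !mxE. Qed.
HB.instance Definition _ := GRing.isLinear.Build R _ _ _ level_vec level_vec_linear.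

Lemma hamming_leq (k r : nat) (x y : {ffun 'I_k -> 'I_r}) : (hamming x y < k.+1)%N.
Proof. by rewrite ltnS -[leqRHS](card_ord k) max_card. Qed.

Lemma level_onto (i : 'I_m.+1) (j : 'I_n.+1) : ~~ ((i == 0) && (j == 0)) ->
  exists k : 'I_#|[set~ a]|,
    hamming a.1 (enum_val k).1 = i /\ hamming a.2 (enum_val k).2 = j.
Proof.
move=> nij; have [x1 l1] := hamming_onto a.1 hp (ltn_ord i : (i <= m)%N).
have [x2 l2] := hamming_onto a.2 hq (ltn_ord j : (j <= n)%N).
have xa : (x1, x2) \in [set~ a].
  rewrite !inE; apply: contraNN nij => /eqP xa.
  by rewrite -!val_eqE /= -l1 -l2 -xa /= !hammingxx.
by exists (enum_rank_in xa (x1, x2)); rewrite enum_rankK_in.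
Qed.

Lemma ker_level_vec : lker (linfun level_vec) = <[delta_mx 0%R 0%R]>%VS.
Proof.
apply/vspaceP => C; rewrite memv_ker lfunE /=; apply/eqP/vlineP => [hC|[c ->]].
  exists (C 0 0); apply/matrixP=> i j; rewrite !mxE.
  have [/andP[/eqP-> /eqP->]|nij] := boolP ((i == 0) && (j == 0)).
    by rewrite mulr1.
  have [k [l1 l2]] := level_onto nij.
  by rewrite mulr0; move/matrixP/(_ k 0): hC; rewrite !mxE l1 l2 !inord_val.
apply/matrixP=> k l; rewrite !mxE.
case: andP => [[/eqP e1 /eqP e2]|_]; last by rewrite mulr0.
have := enum_valP k; rewrite !inE => /eqP[].
move/(congr1 val)/eqP: e1; move/(congr1 val)/eqP: e2.
rewrite /= !inordK ?hamming_leq // !hamming_eq0.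
by case: (a) (enum_val k) => [? ?] [? ?] /= /eqP-> /eqP->.
Qed.

Lemma level_vec_image : (linfun level_vec @: fullv)%VS = orbit_space R G a.
Proof.
apply/vspaceP => v; apply/memv_imgP/orbit_spaceP => [[C _ ->] i j|hv].
  by rewrite orbit_level lfunE /= !mxE => /andP[/eqP-> /eqP->].
pose onlev (i : 'I_m.+1) (j : 'I_n.+1) (k : 'I_#|[set~ a]|) :=
  (hamming a.1 (enum_val k).1 == i) && (hamming a.2 (enum_val k).2 == j).
exists (\matrix_(i, j) if [pick k | onlev i j k] is Some k then v k 0 else 0).
  exact: memvf.
rewrite lfunE /=; apply/matrixP=> k l; rewrite ord1 !mxE.
case: pickP => [k' /andP[] | /(_ k)]; rewrite /onlev !inordK ?hamming_leq // ?eqxx //.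
by move=> h1 h2; apply: hv; rewrite orbit_level eq_sym h1 eq_sym h2.
Qed.

Lemma dim_orbit_space : (\dim (orbit_space R G a)).+1 = (m.+1 * n.+1)%N.
Proof.
have := limg_ker_dim (linfun level_vec) fullv.
rewrite capfv level_vec_image ker_level_vec dimvf dim_matrix dim_vline => h.
apply: etrans h; rewrite -add1n; congr (_ + _)%N.
suff -> : (delta_mx 0 0 : 'M[R]_(m.+1, n.+1)) != 0 by [].
by apply/eqP => /matrixP/(_ 0 0)/eqP; rewrite !mxE oner_eq0.
Qed.

End ProductGraph.

(** * Eigenfunctions of a power of a complete graph *)

Section Krawtchouk.
Variables (m p : nat).
Local Notation T := {ffun 'I_m -> 'I_p}.
Local Notation adj := (cart_pow (complete_graph p) m).
Implicit Types x y a : T.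

(** The neighbours of x that differ from it in coordinate k are a product set,
    over which the sum of a product factorizes. *)
Lemma sum_nbr_prod (A : comNzRingType) (phi : 'I_m -> 'I_p -> A) x :
  \sum_(y | adj x y) \prod_k phi k (y k)
  = \sum_k (\sum_b phi k b - phi k (x k)) * \prod_(l | l != k) phi l (x l).
Proof.
pose Q k : 'I_m -> pred 'I_p := fun l => if l == k then predC1 (x k) else pred1 (x l).
have famE k y : (y \in family (Q k)) = ([set l | x l != y l] == [set k]).
  apply/familyP/eqP => [h|/setP h l].
    apply/setP=> l; have := h l; rewrite /Q !inE.
    by case: (eqVneq l k) => [->|_]; rewrite inE eq_sym => -> //; apply/negbF.
  have := h l; rewrite /Q !inE.
  by case: (eqVneq l k) => [->|_]; rewrite inE eq_sym // => /negbFE.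
transitivity (\sum_k \sum_(y in family (Q k)) \prod_l phi l (y l)).
  rewrite (exchange_big_dep xpredT) //= [LHS]big_mkcond.
  apply: eq_bigr => y _; rewrite cart_pow_complete.
  case: cards1P => [[k hk]|nk].
    rewrite [RHS](big_pred1 k) // => l /=.
    by rewrite famE hk (inj_eq set1_inj) eq_sym.
  rewrite [RHS]big_pred0 // => k; rewrite famE; apply/eqP=> hk.
  by apply: nk; exists k.
apply: eq_bigr => k _; rewrite -bigA_distr_big_dep (bigD1 k) //=; congr (_ * _).
  rewrite [X in _ = X - _](bigD1 (x k)) //= addrAC subrr add0r.
  by apply: eq_bigl => b; rewrite /Q eqxx inE.
apply: eq_bigr => l nl; rewrite [LHS](big_pred1 (x l)) //.
by move=> b; rewrite /Q (negPf nl).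
Qed.

Lemma deriv_prod (A : comNzRingType) (I : finType) (F : I -> {poly A}) :
  (\prod_i F i)^`() = \sum_i (F i)^`() * \prod_(j | j != i) F j.
Proof.
elim: (index_enum I) (index_enum_uniq I) => [|i s IHs] /=; first by rewrite !big_nil derivC.
case/andP=> nis us; rewrite !big_cons derivM IHs // eqxx mulr_sumr; congr (_ + _).
  congr (_ * _); rewrite big_seq [RHS]big_seq_cond; apply: eq_bigl => j /=.
  by case: eqVneq => [->|]; rewrite ?andbT ?andbF // (negPf nis).
rewrite !big_seq; apply: eq_bigr => j js; rewrite big_cons.
have -> : i != j by apply: contraNneq nis => ->.
by rewrite mulrCA.
Qed.

Variables (R : realType) (a : T).

(** The generating polynomial of the Krawtchouk values: its s-th coefficient,
    as a function of x, is an eigenfunction of the adjacency operator. *)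
Definition kraw x : {poly R} :=
  \prod_k (1 + (if x k == a k then p%:R - 1 else -1) *: 'X).

Definition kraw_eig (s : nat) : R := m%:R * (p%:R - 1) - p%:R * s%:R.

(** Each linear factor phi satisfies X phi' = phi - 1 and sums to p over the
    alphabet, so that replacing it by the sum over the other letters gives
    p - phi = (p - 1) phi - p X phi'. *)
Lemma kraw_adj x :
  \sum_(y | adj x y) kraw y
  = (m%:R * (p%:R - 1)) *: kraw x - p%:R *: ('X * (kraw x)^`()).
Proof.
pose phi (k : 'I_m) (b : 'I_p) : {poly R} := 1 + (if b == a k then p%:R - 1 else -1) *: 'X.
have sphi k : \sum_b phi k b = p%:R.
  rewrite big_split /= sumr_const card_ord -scaler_suml.
  rewrite (bigD1 (a k)) //= eqxx (eq_bigr (fun=> -1)); last by move=> b /negPf->.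
  rewrite sumr_const cardC1 card_ord.
  have /prednK <- : (0 < p)%N by case: (a k) => b; apply: leq_ltn_trans.
  by rewrite /= mulNrn -natr1 addrK subrr scale0r addr0.
have dphi k b : 'X * (phi k b)^`() = phi k b - 1.
  rewrite /phi derivD derivC derivZ derivX add0r [RHS]addrAC subrr add0r.
  by rewrite -scalerAr mulr1.
rewrite (sum_nbr_prod phi) deriv_prod mulr_sumr scaler_sumr.
have -> : (m%:R * (p%:R - 1)) *: kraw x = \sum_(k < m) (p%:R - 1) *: kraw x.
  by rewrite sumr_const card_ord -scaler_nat scalerA.
rewrite -sumrB; apply: eq_bigr => k _.
rewrite sphi mulrA dphi /kraw [\prod_k _](bigD1 k) //= -/(phi k (x k)).
rewrite -!mul_polyC polyCB polyC_natr polyC1; ring.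
Qed.

Lemma size_kraw x : (size (kraw x) <= m.+1)%N.
Proof.
apply: leq_trans (size_prod_leq _ _) _; rewrite card_ord leq_subLR addnS ltnS.
rewrite -[X in (_ <= X + _)%N]card_ord -[X in (_ <= _ + X)%N]card_ord addnn -muln2.
rewrite -sum_nat_const leq_sum // => k _.
rewrite (leq_trans (size_polyD _ _)) // geq_max size_poly1 /=.
by rewrite (leq_trans (size_scale_leq _ _)) // size_polyX.
Qed.

Lemma coef_exprD1X_gt0 (c : R) (k s : nat) : 0 < c -> (s <= k)%N ->
  0 < ((1 + c *: 'X) ^+ k)`_s.
Proof.
move=> c0.
have recr j t : ((1 + c *: 'X) ^+ j.+1)`_t
    = ((1 + c *: 'X) ^+ j)`_t + c * (if t is t'.+1 then ((1 + c *: 'X) ^+ j)`_t' else 0).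
  by rewrite exprS mulrDl mul1r coefD -scalerAl coefZ coefXM; case: t.
have ge0 j t : 0 <= ((1 + c *: 'X) ^+ j)`_t.
  elim: j t => [|j IHj] t; first by rewrite expr0 coef1 ler0n.
  by rewrite recr addr_ge0 // mulr_ge0 ?(ltW c0) //; case: t.
elim: k s => [|k IHk] [|s] // sk; first by rewrite expr0 coef1.
  by rewrite recr mulr0 addr0 IHk.
by rewrite recr ltr_wpDl // mulr_gt0 // IHk.
Qed.

Lemma kraw_eigen x (s : nat) :
  \sum_(y | adj x y) (kraw y)`_s = kraw_eig s * (kraw x)`_s.
Proof.
rewrite -coef_sum kraw_adj coefB !coefZ coefXM /kraw_eig mulrBl; congr (_ - _).
by rewrite -mulrA; congr (_ * _); case: s => [|s]; rewrite /= ?mul0r // coef_deriv mulr_natl.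
Qed.

(** Evaluation at 1, where the factors are p or 0. *)
Lemma kraw_sum x : \sum_(s < m.+1) (kraw x)`_s = (p ^ m)%:R * (x == a)%:R.
Proof.
have := horner_coef_wide 1 (size_kraw x).
under eq_bigr do rewrite expr1n mulr1.
move=> <-; rewrite horner_prod.
have [->|nxa] := eqVneq x a.
  rewrite (eq_bigr (fun=> p%:R)) => [|k _].
    by rewrite prodr_const card_ord natrX mulr1.
  rewrite eqxx hornerD hornerZ hornerX hornerC; ring.
rewrite mulr0; move: nxa; rewrite -hamming_eq0 cards_eq0 => /set0Pn[k].
rewrite inE => /negPf nk; rewrite (bigD1 k) //= nk.
by rewrite hornerD hornerZ hornerX hornerC mulr1 subrr mul0r.
Qed.

Lemma kraw_root_gt0 s : (1 < p)%N -> (s <= m)%N -> 0 < (kraw a)`_s.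
Proof.
move=> p1 sm; rewrite /kraw (eq_bigr (fun=> 1 + (p%:R - 1) *: 'X)) => [|k _].
  by rewrite prodr_const card_ord coef_exprD1X_gt0 // subr_gt0 ltr1n.
by rewrite eqxx.
Qed.

Lemma krawE x : kraw x
  = (1 - 'X) ^+ hamming a x * (1 + (p%:R - 1) *: 'X) ^+ (m - hamming a x).
Proof.
rewrite /kraw (bigID (fun k => a k != x k)) /=; congr (_ * _).
  rewrite (eq_bigr (fun=> 1 - 'X)) => [|k]; last first.
    by rewrite eq_sym => /negPf->; rewrite scaleN1r.
  by rewrite prodr_const; congr (_ ^+ _); apply: eq_card => k; rewrite inE.
rewrite (eq_bigr (fun=> 1 + (p%:R - 1) *: 'X)) => [|k]; last first.
  by rewrite negbK => /eqP->; rewrite eqxx.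
rewrite prodr_const -[X in (X - _)%N](card_ord m); congr (_ ^+ _).
rewrite -(cardsC [set k | a k != x k]) /hamming addKn.
by apply: eq_card => k; rewrite !inE.
Qed.

(** The eigenvalues are distinct: the product of the operators A - lambda_u, for
    u <> s, isolates the s-th term, which is nonzero at the root. *)
Lemma kraw_free (c : 'I_m.+1 -> R) : (1 < p)%N ->
  (forall x, \sum_(s < m.+1) c s * (kraw x)`_s = 0) -> forall s, c s = 0.
Proof.
move=> p1 c0 s.
have cr (r : seq 'I_m.+1) x :
    \sum_(t < m.+1) c t * \prod_(u <- r) (kraw_eig t - kraw_eig u) * (kraw x)`_t = 0.
  elim: r x => [|u r IHr] x.
    by under eq_bigr do rewrite big_nil mulr1; apply: c0.
  under eq_bigr => t _ do
    rewrite big_cons mulrCA -mulrA mulrBl mulrCA -kraw_eigen.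
  rewrite sumrB -mulr_sumr IHr mulr0 subr0.
  under eq_bigr do rewrite mulr_sumr.
  by rewrite exchange_big big1.
have := cr [seq u <- enum 'I_m.+1 | u != s] a.
rewrite (bigD1 s) //= [X in _ + X]big1 => [|t ts]; last first.
  have tin : t \in [seq u <- enum 'I_m.+1 | u != s] by rewrite mem_filter ts mem_enum.
  by rewrite (big_rem t) //= subrr mul0r mulr0 mul0r.
have k0 : (kraw a)`_s != 0 by rewrite lt0r_neq0 // kraw_root_gt0 // -ltnS ltn_ord.
rewrite addr0 => /eqP; rewrite !mulf_eq0 (negPf k0) orbF => /orP[/eqP //|].
rewrite prodf_seq_eq0 => /hasP[u].
rewrite mem_filter => /andP[us _] /=; rewrite subr_eq0 => /eqP e.
case/eqP: us; apply/val_inj/eqP; rewrite -(eqr_nat R); apply/eqP.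
have pn0 : p%:R != 0 :> R by rewrite pnatr_eq0 -lt0n ltnW.
by apply: (mulfI pn0); move: e; rewrite /kraw_eig => /addrI/oppr_inj.
Qed.

End Krawtchouk.

(** * Arrays that are affine along the lines of a grid *)

Section SecondDifference.
Variables (R : realType) (m n u v : nat).
Local Notation M := 'M[R]_(m.+1, n.+1).

(** Second differences with step (v, - u), at all the places of the grid where
    three consecutive points fit; the truncated subtraction in the size makes
    the array empty when there are none. *)
Definition second_diff (C : M) : 'M[R]_(m.+1 - 2 * v, n.+1 - 2 * u) :=
  \matrix_(i, j) (C (inord (i + 2 * v)) (inord j)
                  - 2 * C (inord (i + v)) (inord (j + u))
                  + C (inord i) (inord (j + 2 * u))).

Lemma second_diff_linear : linear second_diff.
Proof. by move=> c C D; apply/matrixP=> i j; rewrite !mxE; ring. Qed.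
HB.instance Definition _ :=
  GRing.isLinear.Build R _ _ _ second_diff second_diff_linear.

Definition line_affine : {vspace M} := lker (linfun second_diff).

Lemma line_affineP (C : M) :
  reflect (forall s t, (s + 2 * v <= m)%N -> (t + 2 * u <= n)%N ->
    C (inord (s + 2 * v)) (inord t) + C (inord s) (inord (t + 2 * u))
      = 2 * C (inord (s + v)) (inord (t + u))) (C \in line_affine).
Proof.
rewrite memv_ker lfunE /=; apply: (iffP eqP) => [hC s t hs ht|hC].
  have hi : (s < m.+1 - 2 * v)%N by lia.
  have hj : (t < n.+1 - 2 * u)%N by lia.
  move/matrixP/(_ (Ordinal hi) (Ordinal hj)): hC; rewrite !mxE /= => hC.
  by apply/eqP; rewrite -subr_eq0 -hC; apply/eqP; ring.
apply/matrixP=> i j; rewrite !mxE addrAC hC ?subrr //.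
  by have := ltn_ord i; lia.
by have := ltn_ord j; lia.
Qed.

Hypotheses (u_gt0 : (0 < u)%N) (v_gt0 : (0 < v)%N).

(** An array supported in column J contributes, through its three terms, to the
    columns J, J - u and J - 2 u of its second difference only; so the columns
    of the target can be matched from the last one on. *)
Lemma second_diff_onto : (linfun second_diff @: fullv)%VS = fullv.
Proof.
apply/vspaceP => D; rewrite memvf.
have [J] : exists J : nat, forall i (j : 'I_(n.+1 - 2 * u)), (J <= j)%N -> D i j = 0.
  by exists n.+1 => i j /= h; exfalso; have := ltn_ord j; lia.
elim: J D => [|J IHJ] D D0.
  suff -> : D = 0 by apply: mem0v.
  by apply/matrixP=> i j; rewrite D0 // mxE.
pose C : M := \matrix_(s, t)
  \sum_(i : 'I_(m.+1 - 2 * v))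
    \sum_(j : 'I_(n.+1 - 2 * u) | [&& (i + 2 * v == s)%N, (j == t :> nat) & (t == J :> nat)]) D i j.
have C0 s (t : 'I_n.+1) : (t != J :> nat) -> C s t = 0.
  move=> tJ; rewrite mxE big1 // => i _; rewrite big_pred0 // => j.
  by rewrite (negPf tJ) !andbF.
have hC i (j : 'I_(n.+1 - 2 * u)) : (J <= j)%N -> second_diff C i j = D i j.
  move=> Jj; have := ltn_ord i; have := ltn_ord j => hj hi.
  rewrite mxE [C (inord (i + v)) _]C0; last by rewrite inordK; lia.
  rewrite [C (inord i) _]C0; last by rewrite inordK; lia.
  rewrite mulr0 subr0 addr0; have [jJ|/eqP jJ] := eqVneq (val j) J; last first.
    by rewrite C0 ?D0 ?inordK //; move: jJ => /=; lia.
  rewrite mxE (bigD1 i) //= (big_pred1 j) => [|k]; last first.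
    rewrite !inordK; try lia; rewrite eqxx jJ eqxx andbT /=.
    by rewrite -val_eqE /= -jJ.
  rewrite big1 ?addr0 // => k ki; rewrite big_pred0 // => l.
  by rewrite inordK; last lia; rewrite eqn_add2r val_eqE (negPf ki).
rewrite -(subrK (second_diff C) D) memvD //.
  by apply: IHJ => i j Jj; rewrite [LHS]mxE [X in _ + X]mxE hC // subrr.
by apply/memv_imgP; exists C; rewrite ?memvf ?lfunE.
Qed.

Lemma dim_line_affine :
  (\dim line_affine + (m.+1 - 2 * v) * (n.+1 - 2 * u) = m.+1 * n.+1)%N.
Proof.
have := limg_ker_dim (linfun second_diff) fullv.
by rewrite capfv second_diff_onto !dimvf !dim_matrix.
Qed.

Hypothesis (cop : coprime u v).

(** The points of a line of the grid are successive translates by (v, - u) of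
    the one with least s, because u and v are coprime; the first two points
    determine the affine function and the second differences propagate it. *)
Lemma affine_on_line (C : M) (l : nat) : C \in line_affine ->
  exists alpha beta : R, forall (s : 'I_m.+1) (t : 'I_n.+1),
    (u * s + v * t = l)%N -> C s t = alpha + beta * s%:R.
Proof.
move/line_affineP => hC.
pose P s := (s <= m)%N && [exists t : 'I_n.+1, (u * s + v * t == l)%N].
have [exP|nP] := boolP [exists s : 'I_m.+1, P s]; last first.
  exists 0, 0 => s t hst; case/existsP: nP; exists s; rewrite /P -ltnS ltn_ord.
  by apply/existsP; exists t; apply/eqP.
have {}exP : exists s, P s by case/existsP: exP => s hs; exists s.
have [s0 /andP[s0m /existsP[t0 /eqP l0]] s0min] := ex_minnP exP.
pose c s t := C (inord s) (inord t).
(* On a line with a single point any slope will do: the second entry below is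
   then an arbitrary one. *)
pose beta := (c (s0 + v)%N (t0 - u)%N - c s0 t0) / v%:R.
have vn0 : v%:R != 0 :> R by rewrite pnatr_eq0; lia.
have aff k : (s0 + k * v <= m)%N -> (k * u <= t0)%N ->
    c (s0 + k * v)%N (t0 - k * u)%N = c s0 t0 + beta * (k * v)%:R.
  have [N] := ubnP k; elim: N k => // N IHN [|[|k]] kN hm hu.
  - by rewrite !mul0n addn0 subn0 mulr0 addr0.
  - by rewrite !mul1n /beta divfK // addrC subrK.
  have := hC (s0 + k * v)%N (t0 - k.+2 * u)%N.
  have := IHN k; have := IHN k.+1.
  have t0n := ltn_ord t0.
  have -> : (s0 + k * v + 2 * v = s0 + k.+2 * v)%N by lia.
  have -> : (s0 + k * v + v = s0 + k.+1 * v)%N by lia.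
  have -> : (t0 - k.+2 * u + 2 * u = t0 - k * u)%N by lia.
  have -> : (t0 - k.+2 * u + u = t0 - k.+1 * u)%N by lia.
  rewrite -!/(c _ _) => h1 h2 h3.
  rewrite h1 ?h2 in h3; try lia.
  have {}h3 := h3 ltac:(lia) ltac:(lia).
  move/(canRL (addrK _)): h3 => ->; rewrite !natrM -!natr1; ring.
exists (c s0 t0 - beta * s0%:R), beta => s t hst.
have s0s : (s0 <= s)%N.
  apply: s0min; rewrite /P -ltnS ltn_ord; apply/existsP; exists t; exact/eqP.
have e : (u * (s - s0) = v * (t0 - t))%N.
  by rewrite !mulnBr; nia.
have /dvdnP[k hk] : (v %| s - s0)%N.
  by rewrite -(Gauss_dvdr _ (_ : coprime v u)) 1?coprime_sym // e dvdn_mulr.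
have hs : (s = s0 + k * v :> nat)%N by lia.
have ht : (t0 = t + k * u :> nat)%N by nia.
have := aff k; rewrite -hs.
have -> : (t0 - k * u = t)%N by lia.
rewrite /c !inord_val => ->; [|by rewrite -ltnS ltn_ord|by rewrite ht leq_addl].
rewrite hs natrD; ring.
Qed.

End SecondDifference.

(** * The root space and the spectral coordinates *)

Section RootSpace.
Variables (R : realType) (S : finType) (e : rel S) (a : S).
Local Notation N := #|[set~ a]|.

Lemma root_space1 : const_mx 1 \in root_space R e a.
Proof.
apply/memv_imgP; exists 1%:M; first exact: gen_alg1.
by rewrite lfunE /= mul1mx.
Qed.

Lemma root_space_mul X w : X \in [:: deleted_adj R e a; nbr_diag R e a] ->
  w \in root_space R e a -> X *m w \in root_space R e a.
Proof.
move=> XS /memv_imgP[Y YA ->]; apply/memv_imgP; exists (X *m Y).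
  exact: gen_alg_mull.
by rewrite !lfunE /= mulmxA.
Qed.

Lemma root_space_least (W : {vspace 'cV[R]_N}) : const_mx 1 \in W ->
  (forall w, w \in W -> deleted_adj R e a *m w \in W) ->
  (forall w, w \in W -> nbr_diag R e a *m w \in W) ->
  (root_space R e a <= W)%VS.
Proof.
move=> W1 WB WE.
suff h : (root_alg R e a <= linfun (mulmxr (const_mx 1 : 'cV[R]_N)) @^-1: W)%VS.
  by apply/subvP=> _ /memv_imgP[Y /(subvP h) + ->]; rewrite -memv_preim.
apply: gen_alg_least; first by rewrite -memv_preim lfunE /= mul1mx.
move=> X Y; rewrite !inE => XS; rewrite -!memv_preim !lfunE /= -mulmxA.
by case/orP: XS => /eqP->; [apply: WB | apply: WE].
Qed.

(** The deleted graph loses the contribution of the root to its neighbours. *)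
Lemma deleted_adj_restr (F : S -> R) :
  deleted_adj R e a *m root_restr a F
  = root_restr a (fun x => \sum_(y | e x y) F y)
    - F a *: root_restr a (fun x => (e x a)%:R).
Proof.
apply/matrixP=> k j; rewrite !mxE; set x := enum_val k.
transitivity (\sum_(y in [set~ a]) (e x y)%:R * F y).
  by rewrite [RHS]big_enum_val; apply: eq_bigr => i _; rewrite !mxE.
rewrite big_mkcond [in RHS]big_mkcond /= (bigD1 a) //= [in RHS](bigD1 a) //=.
rewrite !inE eqxx add0r addrAC.
have -> : (if e x a then F a else 0) - F a * (e x a)%:R = 0.
  by case: (e x a); rewrite ?mulr1 ?mulr0 subrr.
rewrite add0r; apply: eq_bigr => y ya; rewrite !inE ya /=.
by case: (e x y); rewrite ?mul1r ?mul0r.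
Qed.

Lemma nbr_diag_restr (F : S -> R) :
  nbr_diag R e a *m root_restr a F
  = root_restr a (fun x => (e a x)%:R * F x).
Proof. by apply/matrixP=> k j; rewrite mul_diag_mx !mxE. Qed.

End RootSpace.

Section SumNbr.
Variables (m p n q : nat) (R : realType).
Local Notation T := ({ffun 'I_m -> 'I_p} * {ffun 'I_n -> 'I_q})%type.
Local Notation adjp := (cart_pow (complete_graph p) m).
Local Notation adjq := (cart_pow (complete_graph q) n).

Lemma sum_nbr_hamming_prod (F : T -> R) (x : T) :
  \sum_(y | hamming_prod x y) F y
  = \sum_(y | adjp x.1 y) F (y, x.2) + \sum_(y | adjq x.2 y) F (x.1, y).
Proof.
rewrite (bigID (fun y : T => y.2 == x.2)) /=; congr (_ + _).
  transitivity (\sum_(y1 | adjp x.1 y1) \sum_(y2 | y2 == x.2) F (y1, y2)).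
    rewrite pair_big; apply: eq_big => [[y1 y2]|[y1 y2]] //=.
    rewrite hamming_prodE cart_pow_complete /= -hamming_eq0 (hammingC y2).
    by case: (hamming x.2 y2) => [|k]; rewrite ?addn0 ?andbF.
  by apply: eq_bigr => y1 _; rewrite big_pred1_eq.
transitivity (\sum_(y1 | y1 == x.1) \sum_(y2 | adjq x.2 y2) F (y1, y2)).
  rewrite pair_big; apply: eq_big => [[y1 y2]|[y1 y2]] //=.
  rewrite hamming_prodE cart_pow_complete /= -!hamming_eq0 (hammingC y2) (hammingC y1).
  by case: (hamming x.2 y2) (hamming x.1 y1) => [|[|k]] [|[|l]].
by rewrite big_pred1_eq.
Qed.

End SumNbr.

Section Spectral.
Variables (R : realType) (m p n q : nat).
Local Notation T := ({ffun 'I_m -> 'I_p} * {ffun 'I_n -> 'I_q})%type.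
Local Notation G := (@hamming_prod m p n q).
Local Notation adjp := (cart_pow (complete_graph p) m).
Local Notation adjq := (cart_pow (complete_graph q) n).
Local Notation M := 'M[R]_(m.+1, n.+1).
Variable a : T.
Implicit Types (x y : T) (C : M).

(** The function on vertices whose coordinates in the basis of products of
    eigenfunctions of the two factors are the entries of C. *)
Definition spectral C x : R :=
  \sum_s \sum_t C s t * ((kraw R a.1 x.1)`_s * (kraw R a.2 x.2)`_t).

Definition eig1 : M := \matrix_(s, t) kraw_eig m p R s.
Definition eig2 : M := \matrix_(s, t) kraw_eig n q R t.
Definition hadamard (D C : M) : M := \matrix_(s, t) (D s t * C s t).

Lemma spectral_lin c C D x :
  spectral (c *: C + D) x = c * spectral C x + spectral D x.
Proof.
rewrite mulr_sumr -big_split; apply: eq_bigr => s _ /=.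
rewrite mulr_sumr -big_split; apply: eq_bigr => t _ /=.
by rewrite !mxE; ring.
Qed.

Lemma spectral_adj1 C x :
  \sum_(y | adjp x.1 y) spectral C (y, x.2) = spectral (hadamard eig1 C) x.
Proof.
rewrite exchange_big; apply: eq_bigr => s _ /=.
rewrite exchange_big; apply: eq_bigr => t _ /=.
rewrite !mxE -mulr_sumr -mulr_suml kraw_eigen; ring.
Qed.

Lemma spectral_adj2 C x :
  \sum_(y | adjq x.2 y) spectral C (x.1, y) = spectral (hadamard eig2 C) x.
Proof.
rewrite exchange_big; apply: eq_bigr => s _ /=.
rewrite exchange_big; apply: eq_bigr => t _ /=.
rewrite !mxE -!mulr_sumr kraw_eigen; ring.
Qed.

Lemma spectral_adj C x :
  \sum_(y | G x y) spectral C y = spectral (hadamard (eig1 + eig2) C) x.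
Proof.
rewrite sum_nbr_hamming_prod spectral_adj1 spectral_adj2.
rewrite -[X in X + _]mul1r -spectral_lin scale1r.
by congr (spectral _ _); apply/matrixP=> s t; rewrite !mxE; ring.
Qed.

Local Notation nV := ((p ^ m)%:R * (q ^ n)%:R : R).

Lemma spectral_one x : spectral (const_mx 1) x = nV * (x == a)%:R.
Proof.
transitivity ((\sum_(s < m.+1) (kraw R a.1 x.1)`_s)
              * (\sum_(t < n.+1) (kraw R a.2 x.2)`_t)).
  rewrite mulr_suml; apply: eq_bigr => s _; rewrite mulr_sumr.
  by apply: eq_bigr => t _; rewrite mxE mul1r.
rewrite !kraw_sum mulrACA; congr (_ * _); rewrite -natrM mulnb.
by case: (x) (a) => ? ? [].
Qed.

Lemma sum_indicator (I : finType) (P : pred I) (b : I) (c : bool) :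
  \sum_(y | P y) ((y == b) && c)%:R = (P b && c)%:R :> R.
Proof.
rewrite big_mkcond (bigD1 b) //= eqxx big1 ?addr0; first by case: (P b).
by move=> y /negPf->; rewrite if_same.
Qed.

(** This is the adjacency operator of the first factor applied to the indicator
    of the root. *)
Lemma spectral_eig1 x :
  spectral eig1 x = nV * (adjp x.1 a.1 && (x.2 == a.2))%:R.
Proof.
have -> : eig1 = hadamard eig1 (const_mx 1).
  by apply/matrixP=> s t; rewrite !mxE mulr1.
rewrite -spectral_adj1; under eq_bigr do rewrite spectral_one.
rewrite -mulr_sumr; congr (_ * _).
rewrite -(sum_indicator (adjp x.1) a.1 (x.2 == a.2)).
by apply: eq_bigr => y _; case: (a).
Qed.

Lemma spectral_eig2 x :
  spectral eig2 x = nV * (adjq x.2 a.2 && (x.1 == a.1))%:R.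
Proof.
have -> : eig2 = hadamard eig2 (const_mx 1).
  by apply/matrixP=> s t; rewrite !mxE mulr1.
rewrite -spectral_adj2; under eq_bigr do rewrite spectral_one.
rewrite -mulr_sumr; congr (_ * _).
rewrite -(sum_indicator (adjq x.2) a.2 (x.1 == a.1)).
by apply: eq_bigr => y _; rewrite andbC; case: (a).
Qed.

(** The eigenfunction with s = t = 0 is constant. *)
Lemma spectral_delta x : spectral (delta_mx 0 0) x = 1.
Proof.
have k0 r k (b y : {ffun 'I_k -> 'I_r}) : (kraw R b y)`_0 = 1.
  rewrite -horner_coef0 horner_prod big1 // => i _.
  by rewrite hornerD hornerC hornerZ hornerX mulr0 addr0.
rewrite /spectral (bigD1 0) //= (bigD1 0) //= mxE eqxx !k0 !mul1r.
rewrite big1 ?addr0 => [|t t0]; last by rewrite mxE (negPf t0) andbF mul0r.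
rewrite big1 ?addr0 // => s s0; rewrite big1 // => t _.
by rewrite mxE (negPf s0) mul0r.
Qed.

Lemma spectral_level C x y : hamming a.1 x.1 = hamming a.1 y.1 ->
  hamming a.2 x.2 = hamming a.2 y.2 -> spectral C x = spectral C y.
Proof. by move=> h1 h2; rewrite /spectral !krawE h1 h2. Qed.

Lemma spectral_inj C : (1 < p)%N -> (1 < q)%N ->
  (forall x, spectral C x = 0) -> C = 0.
Proof.
move=> p1 q1 h; apply/matrixP=> s t; rewrite mxE.
apply: (kraw_free q1 (a := a.2) (c := fun t => C s t)) => x2.
apply: (kraw_free p1 (a := a.1)
  (c := fun s => \sum_(t < n.+1) C s t * (kraw R a.2 x2)`_t)) => x1.
rewrite -[RHS](h (x1, x2)); apply: eq_bigr => s' _; rewrite mulr_suml.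
by apply: eq_bigr => t' _; rewrite -mulrA [_`_s' * _]mulrC.
Qed.

Definition root_spectral C : 'cV[R]_#|[set~ a]| := root_restr a (spectral C).

Lemma root_spectral_linear : linear root_spectral.
Proof. by move=> c C D; apply/matrixP=> k j; rewrite !mxE spectral_lin. Qed.
HB.instance Definition _ :=
  GRing.isLinear.Build R _ _ _ root_spectral root_spectral_linear.

Lemma num_vertices_neq0 : (1 < p)%N -> (1 < q)%N -> nV != 0.
Proof.
by move=> p1 q1; rewrite mulf_neq0 // pnatr_eq0 -lt0n expn_gt0 ltnW.
Qed.

Lemma root_restr_eq0 (F : T -> R) :
  (forall x, x != a -> F x = 0) <-> root_restr a F = 0.
Proof.
have -> : 0 = root_restr a (fun=> 0 : R) by apply/matrixP=> k j; rewrite !mxE.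
exact: root_restrP.
Qed.

Lemma root_spectral_one : root_spectral (const_mx 1) = 0.
Proof.
by apply/root_restr_eq0 => x /negPf xa; rewrite spectral_one xa mulr0.
Qed.

(** The functions that vanish off the root are the multiples of its indicator,
    whose array is constant. *)
Lemma ker_root_spectral : (1 < p)%N -> (1 < q)%N ->
  lker (linfun root_spectral) = <[const_mx 1]>%VS.
Proof.
move=> p1 q1; apply/vspaceP => C; rewrite memv_ker lfunE /=.
apply/eqP/vlineP => [/root_restr_eq0 hC|[c ->]]; last first.
  by rewrite linearZ /= root_spectral_one scaler0.
pose c := spectral C a / nV; exists c.
apply/eqP; rewrite -subr_eq0; apply/eqP/spectral_inj => // x.
rewrite -scaleNr addrC spectral_lin spectral_one.
have [->|xa] := eqVneq x a; last by rewrite !mulr0 add0r hC.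
by rewrite mulr1 mulNr divfK ?addNr // num_vertices_neq0.
Qed.

End Spectral.

(** * The root space of the product graph *)

Section RootSpaceOfProduct.
Variables (R : realType) (m p n q g u v : nat).
Local Notation T := ({ffun 'I_m -> 'I_p} * {ffun 'I_n -> 'I_q})%type.
Local Notation G := (@hamming_prod m p n q).
Local Notation adjp := (cart_pow (complete_graph p) m).
Local Notation adjq := (cart_pow (complete_graph q) n).
Local Notation M := 'M[R]_(m.+1, n.+1).
Local Notation nV := ((p ^ m)%:R * (q ^ n)%:R : R).
Variable a : T.
Hypotheses (hp : (1 < p)%N) (hq : (1 < q)%N) (hpq : p <> q).
Hypotheses (hm : (0 < m)%N) (hn : (0 < n)%N).
Hypotheses (pE : p = (g * u)%N) (qE : q = (g * v)%N) (cop : coprime u v).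

Let g_gt0 : (0 < g)%N. Proof. lia. Qed.
Let u_gt0 : (0 < u)%N. Proof. lia. Qed.
Let v_gt0 : (0 < v)%N. Proof. lia. Qed.
Let nV_n0 : nV != 0 := num_vertices_neq0 R m n hp hq.

Definition nbr1 : 'cV[R]_#|[set~ a]| :=
  root_restr a (fun x => (adjp x.1 a.1 && (x.2 == a.2))%:R).
Definition nbr2 : 'cV[R]_#|[set~ a]| :=
  root_restr a (fun x => (adjq x.2 a.2 && (x.1 == a.1))%:R).

Lemma root_spectral_eig1 : root_spectral a (eig1 R m p n) = nV *: nbr1.
Proof. by apply/matrixP=> k j; rewrite !mxE spectral_eig1. Qed.

Lemma root_spectral_eig2 : root_spectral a (eig2 R m n q) = nV *: nbr2.
Proof. by apply/matrixP=> k j; rewrite !mxE spectral_eig2. Qed.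

Lemma nbrE : root_restr a (fun x => (G x a)%:R) = nbr1 + nbr2.
Proof.
apply/matrixP=> k j; rewrite !mxE; set x := enum_val k.
rewrite -natrD; congr _%:R; rewrite hamming_prodE !cart_pow_complete -!hamming_eq0.
by case: (hamming x.1 a.1) (hamming x.2 a.2) => [|[|i]] [|[|l]].
Qed.

Lemma deleted_adj_spectral C :
  deleted_adj R G a *m root_spectral a C
  = root_spectral a (hadamard (eig1 R m p n + eig2 R m n q) C)
    - spectral a C a *: (nbr1 + nbr2).
Proof.
rewrite deleted_adj_restr nbrE; congr (_ - _).
by apply/root_restrP => x _; rewrite spectral_adj.
Qed.

(** A function in the range of the spectral coordinates is constant on levels,
    in particular on the neighbours of the root in each factor. *)
Lemma nbr_diag_spectral C : exists alpha beta,
  nbr_diag R G a *m root_spectral a C = alpha *: nbr1 + beta *: nbr2.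
Proof.
have [x1 l1] := hamming_onto a.1 hp hm.
have [x2 l2] := hamming_onto a.2 hq hn.
exists (spectral a C (x1, a.2)), (spectral a C (a.1, x2)).
rewrite nbr_diag_restr; apply/matrixP=> k j; rewrite !mxE; set x := enum_val k.
rewrite hamming_prod_sym hamming_prodE !cart_pow_complete -!hamming_eq0.
case e1: (hamming x.1 a.1) => [|[|i]]; case e2: (hamming x.2 a.2) => [|[|l]];
  rewrite /= ?mulr0 ?mul0r ?addr0 ?add0r ?mul1r ?mulr1 //.
  by apply: spectral_level; rewrite /= ?hammingxx ?l2 hammingC.
by apply: spectral_level; rewrite /= ?hammingxx ?l1 hammingC.
Qed.

(** E 1 and E B E 1 are combinations of the two indicators with coefficients
    (1, 1) and (p - 2, q - 2), which are independent since p <> q. *)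
Lemma nbr_in_root_space : nbr1 \in root_space R G a /\ nbr2 \in root_space R G a.
Proof.
have E_in w : w \in root_space R G a -> nbr_diag R G a *m w \in root_space R G a.
  by apply: root_space_mul; rewrite !inE eqxx orbT.
have B_in w : w \in root_space R G a -> deleted_adj R G a *m w \in root_space R G a.
  by apply: root_space_mul; rewrite !inE eqxx.
have s_in : nbr1 + nbr2 \in root_space R G a.
  have <- : nbr_diag R G a *m const_mx 1 = nbr1 + nbr2.
    rewrite -nbrE; apply/matrixP=> k j.
    by rewrite mul_diag_mx !mxE mulr1 hamming_prod_sym.
  by rewrite E_in ?root_space1.
have t_in : (p - 2)%:R *: nbr1 + (q - 2)%:R *: nbr2 \in root_space R G a.
  suff <- : nbr_diag R G a *m (deleted_adj R G a *m (nbr1 + nbr2))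
          = (p - 2)%:R *: nbr1 + (q - 2)%:R *: nbr2 by rewrite E_in ?B_in.
  rewrite -nbrE deleted_adj_restr hamming_prodE !hammingxx scale0r subr0.
  rewrite nbr_diag_restr; apply/matrixP=> k j; rewrite !mxE; set x := enum_val k.
  have -> : \sum_(y | G x y) (G y a)%:R = #|[set z | G x z && G z a]|%:R :> R.
    rewrite -sum1dep_card natr_sum big_mkcondr.
    by apply: eq_bigr => y _; case: (G y a).
  rewrite hamming_prod_sym hamming_prodE !cart_pow_complete -!hamming_eq0.
  case e1: (hamming x.1 a.1) => [|[|i]]; case e2: (hamming x.2 a.2) => [|[|l]];
    rewrite /= ?mulr0 ?mul0r ?addr0 ?add0r ?mul1r ?mulr1 //.
    by rewrite card_common_nbr2.
  by rewrite card_common_nbr1.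
have d0 : (p - 2)%:R - (q - 2)%:R != 0 :> R.
  by rewrite subr_eq0 eqr_nat; apply/eqP; lia.
have n1_in : nbr1 \in root_space R G a.
  rewrite -(scalerK d0 nbr1) memvZ //.
  have <- : (p - 2)%:R *: nbr1 + (q - 2)%:R *: nbr2 - (q - 2)%:R *: (nbr1 + nbr2)
          = ((p - 2)%:R - (q - 2)%:R) *: nbr1.
    by rewrite scalerDr opprD addrACA subrr addr0 scalerBl.
  by rewrite memvB ?memvZ.
split=> //; by have := memvB s_in n1_in; rewrite addrAC subrr add0r.
Qed.

Let K : R := m%:R * (p%:R - 1) + n%:R * (q%:R - 1).

Lemma eig_sumE (s : 'I_m.+1) (t : 'I_n.+1) :
  (eig1 R m p n + eig2 R m n q) s t = K - g%:R * (u * s + v * t)%:R.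
Proof. by rewrite !mxE /kraw_eig /K pE qE !(natrM, natrD); ring. Qed.

Lemma one_line_affine : const_mx 1 \in line_affine R m n u v.
Proof. by apply/line_affineP=> s t _ _; rewrite !mxE mulr1. Qed.

Lemma eig1_line_affine : eig1 R m p n \in line_affine R m n u v.
Proof.
apply/line_affineP=> s t hs ht; rewrite !mxE !inordK; try lia.
by rewrite /kraw_eig !(natrM, natrD); ring.
Qed.

Lemma eig2_line_affine : eig2 R m n q \in line_affine R m n u v.
Proof.
apply/line_affineP=> s t hs ht; rewrite !mxE !inordK; try lia.
by rewrite /kraw_eig !(natrM, natrD); ring.
Qed.

Lemma delta_line_affine : delta_mx 0 0 \in line_affine R m n u v.
Proof.
apply/line_affineP=> s t hs ht; rewrite !mxE -!val_eqE /= !inordK; try lia.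
have -> : (s + 2 * v == 0)%N = false by lia.
have -> : (t + 2 * u == 0)%N = false by lia.
have -> : (s + v == 0)%N = false by lia.
by rewrite andbF mulr0 addr0.
Qed.

(** The multiplier K - (p s + q t) is constant on each line. *)
Lemma hadamard_line_affine C : C \in line_affine R m n u v ->
  hadamard (eig1 R m p n + eig2 R m n q) C \in line_affine R m n u v.
Proof.
move/line_affineP => hC; apply/line_affineP=> s t hs ht.
rewrite ![hadamard _ _ _ _]mxE !eig_sumE !inordK; try lia.
have -> : (u * (s + 2 * v) + v * t = u * (s + v) + v * (t + u))%N by nia.
have -> : (u * s + v * (t + 2 * u) = u * (s + v) + v * (t + u))%N by nia.
by rewrite -mulrDr hC // mulrCA.
Qed.

(** Since 1 is the image of the array supported at s = t = 0, it suffices that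
    B and E stabilize the image: up to combinations of the two indicators of
    neighbours, B multiplies arrays by the eigenvalues and E kills them. *)
Lemma root_space_sub_image :
  (root_space R G a <= linfun (root_spectral a) @: line_affine R m n u v)%VS.
Proof.
set W := (_ @: _)%VS.
have W_spec C : C \in line_affine R m n u v -> root_spectral a C \in W.
  by move=> hC; apply/memv_imgP; exists C; rewrite ?lfunE.
have W_nbr1 : nbr1 \in W.
  by rewrite -(scalerK nV_n0 nbr1) memvZ // -root_spectral_eig1 W_spec ?eig1_line_affine.
have W_nbr2 : nbr2 \in W.
  by rewrite -(scalerK nV_n0 nbr2) memvZ // -root_spectral_eig2 W_spec ?eig2_line_affine.
apply: root_space_least => [|w|w].
- have <- : root_spectral a (delta_mx 0 0 : M) = const_mx 1 :> 'cV[R]_#|[set~ a]|.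
    by apply/matrixP=> k j; rewrite mxE spectral_delta mxE.
  by rewrite W_spec ?delta_line_affine.
- case/memv_imgP=> C hC ->; rewrite lfunE deleted_adj_spectral.
  by rewrite memvB ?memvZ ?memvD // W_spec ?hadamard_line_affine.
- case/memv_imgP=> C hC ->; rewrite lfunE.
  by have [al [be ->]] := nbr_diag_spectral C; rewrite memvD ?memvZ.
Qed.

(** The arrays that give vectors of the root space contain 1 and an affine
    function of s, and admit multiplication by u s + v t, hence by the indicator
    of any line, a polynomial in u s + v t.  An array that is affine on each line
    is a combination of the products of these indicators with 1 and s. *)
Lemma image_sub_root_space :
  (linfun (root_spectral a) @: line_affine R m n u v <= root_space R G a)%VS.
Proof.
have [n1_in n2_in] := nbr_in_root_space.
pose V := (linfun (root_spectral a) @^-1: root_space R G a)%VS.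
have memV C : (C \in V) = (root_spectral a C \in root_space R G a).
  by rewrite -memv_preim lfunE.
pose ell (s : 'I_m.+1) (t : 'I_n.+1) := (u * s + v * t)%N.
have V_one : const_mx 1 \in V by rewrite memV root_spectral_one mem0v.
have V_eig1 : eig1 R m p n \in V by rewrite memV root_spectral_eig1 memvZ.
have V_scale C : C \in V -> hadamard (eig1 R m p n + eig2 R m n q) C \in V.
  rewrite !memV => hC; rewrite -[root_spectral a _](subrK (spectral a C a *: (nbr1 + nbr2))).
  rewrite -deleted_adj_spectral memvD ?memvZ ?memvD //.
  by rewrite root_space_mul // !inE eqxx.
have gn0 : g%:R != 0 :> R by rewrite pnatr_eq0 -lt0n.
have V_ell (r : seq nat) C : C \in V ->
    (\matrix_(s, t) (\prod_(mu <- r) ((ell s t)%:R - mu%:R) * C s t) : M) \in V.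
  move=> hC; elim: r => [|mu r IHr].
    suff -> :
      (\matrix_(s, t) (\prod_(mu <- [::]) ((ell s t)%:R - mu%:R) * C s t) : M) = C by [].
    by apply/matrixP=> s t; rewrite mxE big_nil mul1r.
  set D : M := \matrix_(s, t) _ in IHr.
  suff -> : (\matrix_(s, t) (\prod_(nu <- mu :: r) ((ell s t)%:R - nu%:R) * C s t) : M)
      = (K / g%:R - mu%:R) *: D - g%:R^-1 *: hadamard (eig1 R m p n + eig2 R m n q) D.
    by rewrite memvB ?memvZ ?V_scale.
  apply/matrixP=> s t; rewrite [LHS]mxE [RHS]mxE [_ *: D]lock [X in _ + X]mxE -lock.
  rewrite [X in X + _]mxE [X in _ - X]mxE [hadamard _ _ _ _]mxE eig_sumE -/(ell s t).
  by rewrite big_cons [D s t]mxE; field.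
pose L := (u * m + v * n).+1.
have ellL s t : (ell s t < L)%N.
  by rewrite ltnS leq_add // leq_mul2l -ltnS ltn_ord orbT.
have V_line l C : C \in V -> (\matrix_(s, t) ((ell s t == l)%:R * C s t) : M) \in V.
  move=> hC; pose r := [seq mu <- iota 0 L | mu != l].
  (* Lagrange interpolation at the values of u s + v t on the grid. *)
  pose w : R := \prod_(mu <- r) (l%:R - mu%:R).
  have wn0 : w != 0.
    rewrite prodf_seq_neq0; apply/allP => mu; rewrite mem_filter => /andP[ml _] /=.
    by rewrite subr_eq0 eqr_nat eq_sym.
  suff -> : (\matrix_(s, t) ((ell s t == l)%:R * C s t) : M)
      = w^-1 *: \matrix_(s, t) (\prod_(mu <- r) ((ell s t)%:R - mu%:R) * C s t).
    by rewrite memvZ ?V_ell.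
  apply/matrixP=> s t; rewrite !mxE mulrA; congr (_ * _).
  have [->|nl] := eqVneq (ell s t) l; first by rewrite mulVf.
  rewrite (big_rem (ell s t)) /= ?subrr ?mul0r ?mulr0 //.
  by rewrite mem_filter nl mem_iota /= ellL.
suff h : (line_affine R m n u v <= V)%VS.
  by apply/subvP=> _ /memv_imgP[C /(subvP h) + ->]; rewrite memV lfunE.
apply/subvP=> C hC.
have -> : C = \sum_(l < L) (\matrix_(s, t) ((ell s t == l)%:R * C s t) : M).
  apply/matrixP=> s t; rewrite summxE (bigD1 (Ordinal (ellL s t))) //=.
  rewrite mxE eqxx mul1r big1 ?addr0 // => l nl; rewrite mxE.
  by move: nl; rewrite -val_eqE eq_sym /= => /negPf->; rewrite mul0r.
apply: memv_suml => l _.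
have [al [be hl]] := affine_on_line u_gt0 v_gt0 cop l hC.
have pn0 : p%:R != 0 :> R by rewrite pnatr_eq0 -lt0n ltnW.
suff -> : (\matrix_(s, t) ((ell s t == l)%:R * C s t) : M)
  = (al + be * (m%:R * (p%:R - 1) / p%:R))
      *: (\matrix_(s, t) ((ell s t == l)%:R * (const_mx 1 : M) s t))
    - (be / p%:R) *: (\matrix_(s, t) ((ell s t == l)%:R * eig1 R m p n s t)).
  by rewrite memvB ?memvZ ?V_line.
apply/matrixP=> s t; rewrite !mxE; have [e|_] := eqVneq; last by rewrite !mul0r !mulr0 subrr.
by rewrite (hl _ _ e) /kraw_eig; field.
Qed.

Lemma root_spectral_image :
  (linfun (root_spectral a) @: line_affine R m n u v)%VS = root_space R G a.
Proof. by apply/eqP; rewrite eqEsubv image_sub_root_space root_space_sub_image. Qed.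

Lemma root_space_sub : (root_space R G a <= orbit_space R G a)%VS.
Proof.
rewrite -root_spectral_image; apply/subvP=> _ /memv_imgP[C _ ->].
apply/orbit_spaceP => i j; rewrite orbit_level // lfunE /= !mxE.
by case/andP => /eqP h1 /eqP h2; apply: spectral_level.
Qed.

Lemma dim_root_space :
  ((\dim (root_space R G a)).+1 + (m.+1 - 2 * v) * (n.+1 - 2 * u) = m.+1 * n.+1)%N.
Proof.
have := limg_ker_dim (linfun (root_spectral a)) (line_affine R m n u v).
rewrite ker_root_spectral // root_spectral_image.
rewrite (capv_idPr _) -?memvE ?one_line_affine // dim_vline.
have -> : (const_mx 1 : M) != 0 by apply/eqP => /matrixP/(_ 0 0)/eqP; rewrite !mxE oner_eq0.
by rewrite add1n => ->; rewrite dim_line_affine.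
Qed.

End RootSpaceOfProduct.

Theorem theorem4p5 (R : realType) (p q m n : nat)
    (hp : (2 <= p)%N) (hq : (2 <= q)%N) (hpq : p <> q)
    (hm : (1 <= m)%N) (hn : (1 <= n)%N)
    (a : {ffun 'I_m -> 'I_p} * {ffun 'I_n -> 'I_q}) :
  let G := cart_prod (cart_pow (complete_graph p) m)
                     (cart_pow (complete_graph q) n) in
  let g := gcdn p q in
  let p' := (p %/ g)%N in
  let q' := (q %/ g)%N in
  [/\ (\dim (root_space R G a))%:Z
        = (m%:Z + 1) * (n%:Z + 1)
          - pos_part (m%:Z - 2 * q'%:Z + 1) * pos_part (n%:Z - 2 * p'%:Z + 1) - 1,
      root_defect R G a
        = pos_part (m%:Z - 2 * q'%:Z + 1) * pos_part (n%:Z - 2 * p'%:Z + 1)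
    & root_space R G a = orbit_space R G a <-> (m < 2 * q')%N \/ (n < 2 * p')%N].
Proof.
move=> G g p' q'.
have g0 : (0 < g)%N by rewrite gcdn_gt0 (ltnW hp).
have pE : p = (g * p')%N by rewrite mulnC divnK ?dvdn_gcdl.
have qE : q = (g * q')%N by rewrite mulnC divnK ?dvdn_gcdr.
have cop : coprime p' q'.
  by rewrite /coprime -(eqn_pmul2l g0) muln_gcdr -pE -qE muln1.
have posE (k l : nat) : pos_part (k%:Z - 2 * l%:Z + 1) = (k.+1 - 2 * l)%N%:Z.
  by rewrite /pos_part maxEle; case: ifP; lia.
rewrite !posE /root_defect.
have dP := dim_root_space R a hp hq hpq hm hn pE qE cop.
have dU := dim_orbit_space hp hq hpq R a.
have sub := root_space_sub R a hp hq hpq hm hn pE qE cop.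
rewrite /hamming_prod -/G in dP dU sub.
have AB0 : ((m.+1 - 2 * q') * (n.+1 - 2 * p') == 0)%N
         = (m < 2 * q')%N || (n < 2 * p')%N.
  by rewrite muln_eq0 !subn_eq0.
move: dP AB0; set A := (m.+1 - _)%N; set B := (n.+1 - _)%N => dP AB0.
split; [clearbody A B; nia | clearbody A B; nia |].
split=> [e|/orP]; first by apply/orP; rewrite -AB0; move: dP; rewrite e; lia.
rewrite -AB0 => /eqP AB.
by apply/eqP; rewrite eqEdim sub; move: dP; rewrite AB addn0 -dU => -[->] /=.
Qed.
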